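(* For all positive integers $m$ and $n$ with $2 \le m \le n$, $\gamma^{\rm ID}(P_m \Box P_n) \ge mn/3$.
   Context: $P_n$ is the path on $n$ vertices and $\Box$ denotes the Cartesian product of graphs. $N[x]$ denotes the closed neighborhood of a vertex $x$. An identifying code (ID code) of a graph $F$ is a set $C\subseteq V(F)$ such that $N[x]\cap C\neq\emptyset$ for every vertex $x$ and $N[x]\cap C\neq N[y]\cap C$ for all distinct vertices $x,y$; $\gamma^{\rm ID}(F)$ is the minimum cardinality of an ID code of $F$. *)

(* Defs.v *)
From mathcomp Require Import all_boot all_order all_algebra.

Set Implicit Arguments.
Unset Strict Implicit.
Unset Printing Implicit Defensive.

Record sgraph := SGraph {
  svertex :> finType;
  adj : rel svertex;
  adj_sym : symmetric adj;
  adj_irr : irreflexive adj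
}.

Section PathGraph.
Variable n : nat.

Definition path_adj : rel 'I_n := fun i j => (i.+1 == j) || (j.+1 == i).

Lemma path_adj_sym : symmetric path_adj.
Proof. by move=> i j; rewrite /path_adj orbC. Qed.

Lemma path_adj_irr : irreflexive path_adj.
Proof. by move=> i; rewrite /path_adj orbb gtn_eqF. Qed.

Definition path_graph : sgraph := SGraph path_adj_sym path_adj_irr.
End PathGraph.

Section CartesianProduct.
Variables F G : sgraph.

Definition box_adj : rel (F * G)%type := fun u v =>
  ((u.1 == v.1) && adj u.2 v.2) || ((u.2 == v.2) && adj u.1 v.1).

Lemma box_adj_sym : symmetric box_adj.
Proof.
move=> u v; rewrite /box_adj (eq_sym u.1) (eq_sym u.2).
by rewrite (adj_sym u.1) (adj_sym u.2).
Qed.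

Lemma box_adj_irr : irreflexive box_adj.
Proof. by move=> u; rewrite /box_adj !adj_irr !andbF. Qed.

Definition box : sgraph := SGraph box_adj_sym box_adj_irr.
End CartesianProduct.

Section IdentifyingCodes.
Variable F : sgraph.

Definition cl_neigh (x : F) : {set F} := [set y | (y == x) || adj x y].

Definition id_code (C : {set F}) : bool :=
  [forall x : F, cl_neigh x :&: C != set0] &&
  [forall x : F, forall y : F,
     (x != y) ==> (cl_neigh x :&: C != cl_neigh y :&: C)].

(* A graph with two vertices having the same closed neighborhood has no
   identifying code; [gammaID] then takes the junk value 0. *)
Definition gammaID : nat :=
  if [pick C : {set F} | id_code C] is Some C0
  then #|[arg min_(C < C0 | id_code C) #|C|]|
  else 0.
End IdentifyingCodes.

(* Main.v *)
(** Count the incidences between vertices [x] and codewords in [N[x]].  In a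
    graph of maximum degree [d] each codeword lies in at most [d + 1] closed
    neighborhoods.  At most [#|C|] vertices see a single codeword, because
    distinct vertices see distinct singletons, and all others see at least two.
    Hence [2 #|V| - #|C| <= (d + 1) #|C|]; grids have [d <= 4].  A box of two
    graphs without isolated vertices has no closed twins, so that the whole
    vertex set is an identifying code and [gammaID] is not the junk value. *)

Require Import Defs.
From mathcomp Require Import all_boot all_order all_algebra.
From mathcomp Require Import zify.

Set Implicit Arguments.
Unset Strict Implicit.
Unset Printing Implicit Defensive.

Import GRing.Theory Num.Theory.

Lemma cl_neigh_sym (F : sgraph) (x y : F) :
  (y \in cl_neigh x) = (x \in cl_neigh y).
Proof. by rewrite !inE eq_sym adj_sym. Qed.

(** Double counting of the pairs [(x, c)] with [c] in [C] and in [N[x]], using the symmetry of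
    closed neighborhoods. *)
Lemma sum_card_cl_neigh (F : sgraph) (C : {set F}) :
  \sum_(x : F) #|cl_neigh x :&: C| = \sum_(c in C) #|cl_neigh c|.
Proof.
transitivity (\sum_(x : F) \sum_(c in C | c \in cl_neigh x) 1).
  apply: eq_bigr => x _; rewrite -sum1_card.
  by apply: eq_bigl => c; rewrite in_setI andbC.
rewrite (exchange_big_dep (mem C)) /= => [|x c _ /andP[] //].
apply: eq_bigr => c cC; rewrite -sum1_card.
by apply: eq_bigl => x; rewrite cC /= cl_neigh_sym.
Qed.

Lemma card_single_codeword (F : sgraph) (C : {set F}) :
  id_code C -> #|[set x : F | #|cl_neigh x :&: C| == 1]| <= #|C|.
Proof.
case/andP=> _ /forallP sepC.
have injC : injective (fun x : F => cl_neigh x :&: C).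
  move=> x y eqxy; apply/eqP; apply: contraT => nxy.
  by have /forallP/(_ y) := sepC x; rewrite nxy eqxy eqxx.
(* Both cardinals become those of families of sets: traces of size one on the left, singletons of
   codewords on the right. *)
rewrite -(card_imset _ injC) -[leqRHS](card_imset _ set1_inj).
apply/subset_leq_card/subsetP => _ /imsetP[x + ->].
rewrite inE => /cards1P[c defc]; rewrite defc imset_f //.
have: c \in cl_neigh x :&: C by rewrite defc set11.
by case/setIP.
Qed.

Lemma id_code_lower_bound (F : sgraph) (d : nat) (C : {set F}) :
  (forall x : F, #|cl_neigh x| <= d.+1) -> id_code C ->
  2 * #|F| <= d.+2 * #|C|.
Proof.
move=> degF idC; have domC := andP idC.
have le_inc : \sum_(c in C) #|cl_neigh c| <= #|C| * d.+1.
  by rewrite -sum_nat_const; apply: leq_sum => c _; apply: degF.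
rewrite [leqRHS]mulSn [d.+1 * _]mulnC.
apply: leq_trans (leq_add (card_single_codeword idC) le_inc).
(* The two sums merge into one over vertices: a trace of size 1 earns an extra 1, so every term is
   at least 2, as domination excludes empty traces. *)
rewrite -sum_card_cl_neigh -sum1_card big_mkcond -big_split /= mulnC.
rewrite -sum_nat_const; apply: leq_sum => x _; rewrite inE.
have /forallP/(_ x) := domC.1; rewrite -card_gt0.
by case: #|_| => [|[|k]].
Qed.

Lemma gammaID_lower_bound (F : sgraph) (d : nat) :
  (forall x : F, #|cl_neigh x| <= d.+1) -> injective (@cl_neigh F) ->
  2 * #|F| <= d.+2 * gammaID F.
Proof.
move=> degF twin_free; rewrite /gammaID; case: pickP => [C0 idC0 | noC].
  by case: arg_minnP => // C idC _; apply: id_code_lower_bound.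
have /negP[] := negbT (noC setT); apply/andP; split.
  by apply/forallP => x; apply/set0Pn; exists x; rewrite !inE eqxx.
apply/forallP => x; apply/forallP => y; apply/implyP.
by apply: contra_neq; rewrite !setIT; apply: twin_free.
Qed.

Lemma adj_neq (F : sgraph) (x y : F) : adj x y -> (x == y) = false.
Proof. by apply: contraTF => /eqP->; rewrite adj_irr. Qed.

(** Distinct twins would be adjacent, hence agree in one coordinate; moving one of them along an
    edge in that coordinate reaches a vertex outside the closed neighborhood of the other. *)
Lemma box_twin_free (F G : sgraph) :
  (forall x : F, exists y, adj x y) -> (forall x : G, exists y, adj x y) ->
  injective (@cl_neigh (box F G)).
Proof.
move=> nisoF nisoG [x1 x2] [y1 y2] eqN.
have: (y1, y2) \in cl_neigh ((x1, x2) : box F G) by rewrite eqN !inE eqxx.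
rewrite !inE => /orP[/eqP-> // | /orP[] /andP[/= /eqP eqxy adjxy]].
  rewrite -{}eqxy in eqN *; have [z xz] := nisoF x1.
  have: (z, x2) \in cl_neigh ((x1, x2) : box F G).
    by rewrite !inE /= /box_adj /= eqxx xz !orbT.
  rewrite eqN !inE /= /box_adj /= xpair_eqE (eq_sym z) (eq_sym y2).
  by rewrite (adj_neq xz) (adj_neq adjxy).
rewrite -{}eqxy in eqN *; have [z xz] := nisoG x2.
have: (x1, z) \in cl_neigh ((x1, x2) : box F G).
  by rewrite !inE /= /box_adj /= eqxx xz !orbT.
rewrite eqN !inE /= /box_adj /= xpair_eqE (eq_sym z) (eq_sym y1).
by rewrite (adj_neq xz) (adj_neq adjxy) andbF.
Qed.

Lemma card_cl_neigh_box (F G : sgraph) (x : box F G) :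
  #|cl_neigh x| <= (#|adj x.1| + #|adj x.2|).+1.
Proof.
have sub : cl_neigh x \subset
    x |: (setX [set y | adj x.1 y] [set x.2] :|:
          setX [set x.1] [set y | adj x.2 y]).
  apply/subsetP => y; rewrite !inE => /orP[-> // | /orP[] /andP[/eqP<- ->]];
    by rewrite eqxx ?orbT.
apply: leq_trans (subset_leq_card sub) _.
rewrite -add1n (leq_trans (leq_card_setU _ _)) // cards1 leq_add2l.
by rewrite (leq_trans (leq_card_setU _ _)) // !cardsX !cards1 muln1 mul1n !cardsE.
Qed.

Lemma path_degree (n : nat) (i : path_graph n) : #|adj i| <= 2.
Proof.
(* For [i = 0] the entry [i.-1] is [0] itself, a spurious value that is harmless in an upper
   bound. *)
rewrite cardE -(size_map val) -[2]/(size [:: i.+1; i.-1]).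
apply: uniq_leq_size => [|_ /mapP[j + ->]].
  by rewrite (map_inj_uniq val_inj) enum_uniq.
rewrite mem_enum inE /= /path_adj !inE => /orP[] /eqP adjij; lia.
Qed.

Lemma path_not_isolated (n : nat) (i : path_graph n) :
  2 <= n -> exists j, adj i j.
Proof.
case: i => i /= ltin n_gt1; have [lt1 | ge1] := ltnP i.+1 n.
  by exists (Ordinal lt1); rewrite /path_adj /= eqxx.
(* Here [i] is the last vertex, and [2 <= n] makes [i.-1] a true predecessor. *)
have lt2 : i.-1 < n by lia.
by exists (Ordinal lt2); rewrite /path_adj /=; lia.
Qed.

Theorem theorem16 (m n : nat) (hm : (2 <= m)%N) (hmn : (m <= n)%N) :
  ((gammaID (box (path_graph m) (path_graph n)))%:R
     >= (m * n)%:R / 3%:R :> rat)%R.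
Proof.
have deg_box (x : box (path_graph m) (path_graph n)) : #|cl_neigh x| <= 5.
  apply: leq_trans (card_cl_neigh_box x) _; rewrite ltnS.
  exact: (leq_add (path_degree _) (path_degree _)).
have twin_free : injective (@cl_neigh (box (path_graph m) (path_graph n))).
  apply: box_twin_free => i; apply: path_not_isolated => //.
  exact: leq_trans hmn.
(* With [d = 4] the bound reads [2mn <= 6 gammaID], which is three times the claim after halving. *)
have := gammaID_lower_bound deg_box twin_free.
rewrite card_prod !card_ord => bound.
rewrite ler_pdivrMr ?ltr0n // -natrM ler_nat; lia.
Qed.
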